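(* Let $f(x)\in GR(p^a,m)[x]$ be a regular monic polynomial and let $C$ be an ideal of $\mathcal{R}=\frac{GR(p^a,m)[x]}{\langle f(x)\rangle}$. Then $$C=\langle p^{j_0}g_0(x),\dots,p^{j_r}g_r(x)\rangle$$ where $0\le r\le a-1$ and (1) $0\le j_0<\dots<j_r\le a-1$; (2) $g_i(x)$ is monic for $i=0,\dots,r$; (3) $\deg f(x)>\deg g_0(x)>\dots>\deg g_r(x)$; (4) $p^{j_{i+1}}g_i(x)\in\langle p^{j_{i+1}}g_{i+1}(x),\dots,p^{j_r}g_r(x)\rangle$ for $0\le i<r$; (5) $p^{j_0}f(x)\in\langle p^{j_0}g_0(x),\dots,p^{j_r}g_r(x)\rangle$ in $GR(p^a,m)[x]$.
   Context: $p$ is a prime, $a,m\ge1$; $GR(p^a,m)$ is the Galois ring of characteristic $p^a$ with $p^{am}$ elements. A polynomial in $GR(p^a,m)[x]$ is regular if it is not a zero divisor. The $j_i$ are integers and the $g_i(x)$ are polynomials in $GR(p^a,m)[x]$. Polynomials of degree less than $\deg f(x)$ are identified with their classes in $\mathcal{R}$; in (4) the membership is in $\mathcal{R}$.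
   Formalization: The ideal C is assumed nonzero: for C = 0 the claim fails, since a generator p^{j_0}g_0 with j_0 ≤ a-1, g_0 monic and deg g_0 < deg f is never zero in the quotient. *)

(* Defs.v *)
From HB Require Import structures.
From mathcomp Require Import all_boot all_order all_algebra.

Set Implicit Arguments.
Unset Strict Implicit.
Unset Printing Implicit Defensive.

Import GRing.Theory.
Local Open Scope ring_scope.

Definition is_ideal (S : comPzRingType) (I : S -> Prop) : Prop :=
  [/\ I 0,
      forall x y, I x -> I y -> I (x + y) &
      forall s x, I x -> I (s * x)].

(* The ideal <h m, ..., h (n - 1)>; the upper bound n is excluded. *)
Definition ideal_gen (S : comPzRingType) (h : nat -> S) (m n : nat) : S -> Prop :=
  fun x => exists c : nat -> S, x = \sum_(m <= k < n) c k * h k.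

(* pi presents Q as the quotient ring S[x]/<f>: it is a surjective ring
   morphism whose kernel is <f>, so Q is S[x]/<f> up to isomorphism, pi being
   the map to classes. The library's {poly %/ f} is not used because it
   silently replaces a constant f by 'X, whereas S[x]/<1> is the zero ring;
   this is also why Q is not required to be a nontrivial ring. *)
Definition poly_quotient (S : comNzRingType) (f : {poly S}) (Q : comPzRingType)
    (pi : {rmorphism {poly S} -> Q}) : Prop :=
  (forall y : Q, exists q : {poly S}, pi q = y) /\
  (forall q : {poly S}, pi q = 0 <-> exists u : {poly S}, q = u * f).

Definition mod_p_poly (p a : nat) (h : {poly 'Z_(p ^ a)}) : {poly 'F_p} :=
  map_poly (fun x : 'Z_(p ^ a) => (x : nat)%:R : 'F_p) h.

Definition basic_irreducible (p a : nat) (h : {poly 'Z_(p ^ a)}) : Prop :=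
  irreducible_poly (mod_p_poly h).

(* GR(p^a, m) is (Z/p^a)[y]/<h> for h monic, basic irreducible of degree m; it
   does not depend on h up to isomorphism. Meaningful for p prime and a > 0,
   in which case 'Z_(p ^ a) is indeed Z/p^a. *)
Definition is_galois_ring (p a m : nat) (GR : comNzRingType) : Prop :=
  exists (h : {poly 'Z_(p ^ a)}) (pi : {rmorphism {poly 'Z_(p ^ a)} -> GR}),
    [/\ h \is monic, size h = m.+1, basic_irreducible h & poly_quotient h pi].

Definition regular_poly (S : comNzRingType) (f : {poly S}) : Prop :=
  ~ exists2 q : {poly S}, q != 0 & f * q = 0.

(* Main.v *)
Require Import Defs.
From HB Require Import structures.
From mathcomp Require Import all_boot all_order all_algebra.
From mathcomp Require Import zify ring.
From Stdlib Require Import Classical.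

Set Implicit Arguments.
Unset Strict Implicit.
Unset Printing Implicit Defensive.

Import GRing.Theory.
Local Open Scope ring_scope.

(** The argument works over any commutative ring S with a nilpotent element t
    such that every element of S is a unit or a multiple of t; the Galois ring
    is such a ring with t = p. Indeed, if x is the class of q in
    (Z/p^a)[y]/<h>, then modulo p the irreducible h either divides q, and x is
    a multiple of p, or is coprime to q, and a Bezout relation makes x
    invertible modulo the nilpotent p, hence invertible
    ([galois_ring_local]).

    Let I be the preimage of C in S[x] and J_k = (I : t^k), an increasing
    sequence of ideals, all containing the monic f. Let G_k be a monic
    polynomial of least degree in J_k.

    Division by G_k sends h in J_k to a remainder which lies in J_k and has
    degree less than that of G_k. This remainder is a multiple of t: otherwise
    some scalar multiple of it is R + t s with R monic of small degree, and a
    Nakayama argument ([monic_of_monic_mod]) turns it into a monic element of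
    J_k of the degree of R, against the choice of G_k. Hence
    h = A G_k + t r with t^k (t r) in I, that is r in J_{k+1}
    ([min_monic_division]). Iterating until t^a = 0, the t^l G_l with
    k <= l < a generate t^k J_k.

    If G_k still has least degree in J_{k+1}, one takes G_{k+1} = G_k, and
    t^{k+1} G_{k+1} is a redundant generator. What is left is one generator for
    each k where the least degree drops, whence the strict inequalities between
    exponents and between degrees. Each generator lies in the colon ideals of
    all later exponents, so that t^l times it belongs to the ideal of the later
    generators, l being the next exponent. The descending
    induction on k in [min_monic_chain] builds this list. For k = 0 the list
    may start with f itself, when f has least degree in J_0; then f is
    discarded, being 0 in the quotient, and the list remains nonempty because C
    is not zero ([strong_generators]). *)

(** * Ideals and their generators *)

Lemma idealN (S : comPzRingType) (I : S -> Prop) (x : S) :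
  is_ideal I -> I x -> I (- x).
Proof. by case=> _ _ IM Ix; rewrite -mulN1r; apply: IM. Qed.

Lemma idealB (S : comPzRingType) (I : S -> Prop) (x y : S) :
  is_ideal I -> I x -> I y -> I (x - y).
Proof.
move=> idI Ix Iy; case: (idI) => _ ID _; apply: ID => //.
exact: idealN.
Qed.

Lemma ideal_gen_is_ideal (S : comPzRingType) (h : nat -> S) (m n : nat) :
  is_ideal (ideal_gen h m n).
Proof.
split=> [|x y [c ->] [d ->]|s x [c ->]].
- by exists (fun=> 0); rewrite big1 // => i _; rewrite mul0r.
- exists (fun i => c i + d i); rewrite -big_split.
  by apply: eq_bigr => i _; rewrite mulrDl.
- exists (fun i => s * c i); rewrite mulr_sumr.
  by apply: eq_bigr => i _; rewrite mulrA.
Qed.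

Lemma mem_ideal_gen (S : comPzRingType) (h : nat -> S) (m n k : nat) :
  (m <= k < n)%N -> ideal_gen h m n (h k).
Proof.
move=> k_mn; exists (fun i => (i == k)%:R).
rewrite (bigD1_seq k) ?mem_index_iota ?iota_uniq //= eqxx mul1r.
by rewrite big1 ?addr0 // => i /negPf ->; rewrite mul0r.
Qed.

Lemma ideal_gen_sub (S : comPzRingType) (I : S -> Prop) (h : nat -> S)
    (m n : nat) (x : S) :
    is_ideal I -> (forall k, (m <= k < n)%N -> I (h k)) ->
  ideal_gen h m n x -> I x.
Proof.
case=> I0 ID IM Ih [c ->]; rewrite big_nat.
by elim/big_ind: _ => // k k_mn; apply/IM/Ih.
Qed.

Lemma eq_ideal_gen (S : comPzRingType) (h h' : nat -> S) (m n : nat) (x : S) :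
  h =1 h' -> ideal_gen h m n x -> ideal_gen h' m n x.
Proof. by move=> eq_h [c ->]; exists c; apply: eq_bigr => k _; rewrite eq_h. Qed.

Lemma ideal_gen_shift (S : comPzRingType) (h : nat -> S) (m n : nat) (x : S) :
  ideal_gen h m.+1 n.+1 x <-> ideal_gen (fun i => h i.+1) m n x.
Proof.
split=> [] [c ->]; first by exists (fun i => c i.+1); rewrite big_add1.
by exists (fun i => c i.-1); rewrite big_add1.
Qed.

Lemma ideal_gen_morph (S T : comPzRingType) (phi : {rmorphism S -> T})
    (h : nat -> S) (m n : nat) (x : S) :
  ideal_gen h m n x -> ideal_gen (fun i => phi (h i)) m n (phi x).
Proof.
case=> c ->; exists (fun i => phi (c i)); rewrite rmorph_sum.
by apply: eq_bigr => k _; rewrite rmorphM.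
Qed.

(** * Monic polynomials in ideals over a local ring with nilpotent uniformizer *)

(** For nilpotent t, this says that S is a local ring with maximal ideal <t>. *)
Definition local_uniformizer (S : comNzRingType) (t : S) : Prop :=
  forall x : S, (exists y, x = t * y) \/ (exists y, y * x = 1).

(** The colon ideal (I : t^k). *)
Definition colon_ideal (S : comNzRingType) (t : S) (I : {poly S} -> Prop)
  (k : nat) : {poly S} -> Prop := fun h => I (t ^+ k *: h).

Definition min_monic (S : comNzRingType) (J : {poly S} -> Prop)
    (G : {poly S}) : Prop :=
  [/\ G \is monic, J G &
      forall H : {poly S}, H \is monic -> J H -> (size G <= size H)%N].

Lemma idealZ (S : comNzRingType) (I : {poly S} -> Prop) (c : S) (h : {poly S}) :
  is_ideal I -> I h -> I (c *: h).
Proof. by case=> _ _ IM Ih; rewrite -mul_polyC; apply: IM. Qed.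

Lemma colon_ideal_is_ideal (S : comNzRingType) (t : S) (I : {poly S} -> Prop)
    (k : nat) :
  is_ideal I -> is_ideal (colon_ideal t I k).
Proof.
case=> I0 ID IM; rewrite /colon_ideal; split=> [|x y Ix Iy|s x Ix].
- by rewrite scaler0.
- by rewrite scalerDr; apply: ID.
- by rewrite scalerAr; apply: IM.
Qed.

Lemma colon_idealS (S : comNzRingType) (t : S) (I : {poly S} -> Prop)
    (k : nat) (h : {poly S}) :
  is_ideal I -> colon_ideal t I k h -> colon_ideal t I k.+1 h.
Proof. by move=> idI Ih; rewrite /colon_ideal exprS -scalerA; apply: idealZ. Qed.

(** Membership in J is not decidable, hence the classical case analysis in the
    descent on the size of F. *)
Lemma min_monic_exists (S : comNzRingType) (J : {poly S} -> Prop)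
    (F : {poly S}) :
    F \is monic -> J F ->
  exists2 G, min_monic J G & (size G <= size F)%N.
Proof.
have [n] := ubnP (size F); elim: n F => // n IHn F leFn monF JF.
have [[H [monH JH ltHF]]|noH] := classic (exists H : {poly S},
    [/\ H \is monic, J H & (size H < size F)%N]).
  have [|G minG leGH] := IHn H _ monH JH; first exact: leq_trans ltHF leFn.
  by exists G => //; apply: leq_trans leGH (ltnW ltHF).
exists F => //; split=> // H monH JH; rewrite leqNgt; apply/negP => ltHF.
by case: noH; exists H.
Qed.

(** R comes from the terms of q up to the last one whose coefficient is a unit:
    the coefficients after that one are multiples of t. *)
Lemma monic_part (S : comNzRingType) (t : S) (q : {poly S}) :
    local_uniformizer t ->
  (exists q' : {poly S}, q = t *: q') \/
  exists c (R s : {poly S}),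
    [/\ R \is monic, (size R <= size q)%N & c *: q = R + t *: s].
Proof.
move=> locS; have [n] := ubnP (size q); elim: n q => // n IHn q leqn.
have [->|q_neq0] := eqVneq q 0; first by left; exists 0; rewrite scaler0.
have [[y lq]|[c lq]] := locS (lead_coef q); last first.
  right; exists c, (c *: q), 0; rewrite scaler0 addr0 size_scale_leq; split=> //.
  have szq: size (c *: q) = size q.
    apply/eqP; rewrite eqn_leq size_scale_leq (polySpred q_neq0) ltnNge /=.
    apply/negP => /leq_sizeP/(_ _ (leqnn _)).
    by rewrite coefZ -lead_coefE lq => /eqP; rewrite oner_eq0.
  by rewrite monicE lead_coefE szq coefZ -lead_coefE lq.
pose q0 := q - (t * y) *: 'X^((size q).-1).
have szq0 : (size q0 < size q)%N.
  rewrite (polySpred q_neq0) ltnS; apply/leq_sizeP => i.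
  rewrite leq_eqVlt coefB coefZ coefXn => /predU1P[<-|lti].
    by rewrite eqxx mulr1 -lq lead_coefE subrr.
  rewrite gtn_eqF // mulr0 subr0 nth_default //.
  by rewrite (polySpred q_neq0).
have def_q : q = q0 + t *: (y *: 'X^((size q).-1)) by rewrite scalerA subrK.
move: q0 szq0 def_q => q0 szq0 def_q.
have [|[q' dq']|[c [R [s [monR leR eqR]]]]] := IHn q0.
- exact: leq_trans szq0 leqn.
- left; exists (q' + y *: 'X^((size q).-1)).
  by rewrite scalerDr -dq'.
- right; exists c, R, (s + c *: (y *: 'X^((size q).-1))); split=> //.
    exact: leq_trans leR (ltnW szq0).
  rewrite [in LHS]def_q scalerDr eqR scalerDr addrA !scalerA.
  by congr (_ + _ *: _); ring.
Qed.

(** This is Nakayama's lemma for S[x]/J, with t nilpotent. Modulo J and t every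
    polynomial reduces to one of degree less than that of R, by division by R;
    reducing the multiple of t again and again improves this to a reduction
    modulo J and t^n for all n, hence modulo J alone. Applied to the monomial of
    the degree of R, this gives the monic element of J. *)
Lemma monic_of_monic_mod (S : comNzRingType) (t : S) (a : nat)
    (J : {poly S} -> Prop) (R s : {poly S}) :
    t ^+ a = 0 -> is_ideal J -> R \is monic -> J (R + t *: s) ->
  exists G, [/\ G \is monic, size G = size R & J G].
Proof.
move=> ta0 idJ monR JRs; case: (idJ) => J0 JD JM.
have red n (q : {poly S}) : exists q' s' : {poly S},
    (size q' < size R)%N /\ J (q - q' - t ^+ n *: s').
  elim: n => [|n [q' [s' [szq' Jq]]]].
    exists 0, q; rewrite size_poly0 size_poly_gt0 monic_neq0 //.
    by rewrite expr0 scale1r subr0 subrr.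
  pose A := Pdiv.Ring.rdivp s' R; pose r := Pdiv.Ring.rmodp s' R.
  have def_s' : s' = A * R + r := Pdiv.RingMonic.rdivp_eq monR s'.
  exists (q' + t ^+ n *: r), (- (A * s)); split.
    rewrite (leq_ltn_trans (size_polyD _ _)) // gtn_max szq'.
    rewrite (leq_ltn_trans (size_scale_leq _ _)) //.
    by rewrite Pdiv.Ring.ltn_rmodp ?monic_neq0.
  have -> : q - (q' + t ^+ n *: r) - t ^+ n.+1 *: (- (A * s)) =
      (q - q' - t ^+ n *: s') + (t ^+ n *: A) * (R + t *: s).
    rewrite [in RHS]def_s' -!mul_polyC exprS !rmorphM /=; ring.
  by apply: JD => //; apply: JM.
(* At n = a the multiple of t^n vanishes. *)
have [q' [s' [szq']]] := red a 'X^((size R).-1).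
rewrite ta0 scale0r subr0 => JG; exists ('X^((size R).-1) - q').
have szR : size R = (size R).-1.+1 by rewrite -polySpred ?monic_neq0.
have ltq' : (size (- q') < size ('X^((size R).-1) : {poly S}))%N.
  by rewrite size_polyN size_polyXn -szR.
split=> //; last by rewrite size_polyDl // size_polyXn -szR.
by rewrite monicE lead_coefDl // lead_coefXn.
Qed.

(** The remainder of h modulo G lies in J. If it were not a multiple of t, its
    monic part would give a monic element of J smaller than G. *)
Lemma min_monic_division (S : comNzRingType) (t : S) (a : nat)
    (J : {poly S} -> Prop) (G h : {poly S}) :
    t ^+ a = 0 -> local_uniformizer t -> is_ideal J -> min_monic J G -> J h ->
  exists A r, h = A * G + t *: r.
Proof.
move=> ta0 locS idJ [monG JG minG] Jh; case: (idJ) => J0 JD JM.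
pose A := Pdiv.Ring.rdivp h G; pose r := Pdiv.Ring.rmodp h G.
have def_h : h = A * G + r := Pdiv.RingMonic.rdivp_eq monG h.
have Jr : J r.
  have -> : r = h - A * G by rewrite def_h addrC addKr.
  by apply: idealB => //; apply: JM.
have [[r' dr]|[c [R [s [monR leR eqR]]]]] := monic_part r locS.
  by exists A, r'; rewrite -dr.
have JRs : J (R + t *: s) by rewrite -eqR; apply: idealZ.
have [H [monH szH JH]] := monic_of_monic_mod ta0 idJ monR JRs.
have := leq_trans (minG H monH JH) _; rewrite szH => /(_ _ leR).
by rewrite leqNgt Pdiv.Ring.ltn_rmodp monic_neq0.
Qed.

(** * Strong generating chains *)

(** The chain starts at an arbitrary exponent j 0, so that it can be extended on
    the left. The last clause is stated in S[x], which is stronger than the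
    same membership in the quotient by f. *)
Definition generator_chain (S : comNzRingType) (t : S) (a : nat)
    (I : {poly S} -> Prop) (r : nat) (j : nat -> nat)
    (g : nat -> {poly S}) : Prop :=
  let b i := t ^+ j i *: g i in
  [/\ forall i, (i < r)%N -> (j i < j i.+1)%N,
      (j r < a)%N,
      forall i, (i <= r)%N -> g i \is monic /\ I (b i),
      forall i, (i < r)%N -> (size (g i.+1) < size (g i))%N &
      forall i, (i < r)%N -> ideal_gen b i.+1 r.+1 (t ^+ j i.+1 *: g i)].

(** Descending induction on k, from k = a - 1. Let G' be a monic polynomial of
    least degree in (I : t^(k+1)), an ideal that contains G. If G' has smaller
    degree than G, then t^k G is put in front of the chain that starts with
    t^(k+1) G'. Otherwise G also has least degree in (I : t^(k+1)), and in the
    chain that starts with t^(k+1) G this first generator becomes t^k G. *)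
Lemma min_monic_chain (S : comNzRingType) (t : S) (a : nat)
    (I : {poly S} -> Prop) (k : nat) (G : {poly S}) :
    t ^+ a = 0 -> local_uniformizer t -> is_ideal I -> (k < a)%N ->
    min_monic (colon_ideal t I k) G ->
  exists r j g, [/\ generator_chain t a I r j g, j 0%N = k, g 0%N = G &
    forall h, colon_ideal t I k h ->
      ideal_gen (fun i => t ^+ j i *: g i) 0 r.+1 (t ^+ k *: h)].
Proof.
move=> ta0 locS idI lt_ka; have [d def_a] : exists d, a = (k + d.+1)%N.
  by exists (a - k.+1)%N; lia.
elim: d k G {lt_ka} def_a => [|d IHd] k G def_a minG.
all: have [monG JG _] := minG; have idJ := colon_ideal_is_ideal t k idI.
all: have divG h := min_monic_division ta0 locS idJ minG (h := h).
  (* As k = a - 1, the multiple of t left by division is killed by t^k. *)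
  exists 0%N, (fun=> k), (fun=> G); split=> //.
    by split=> //=; rewrite def_a addn1.
  have tk0 : t ^+ k.+1 = 0 by rewrite -addn1 -def_a.
  move=> h /divG[A [r ->]]; rewrite scalerDr scalerA -exprSr tk0.
  rewrite scale0r addr0 scalerAr; case: (ideal_gen_is_ideal
    (fun i => t ^+ k *: G) 0 1) => _ _; apply.
  exact: (mem_ideal_gen (fun i => t ^+ k *: G) (k := 0%N)).
have JSG := colon_idealS idI JG.
(* A family generates t^k (I : t^k) as soon as its ideal contains t^k G and
   t^(k+1) (I : t^(k+1)). *)
have gen_step (b : nat -> {poly S}) r h :
    ideal_gen b 0 r.+1 (t ^+ k *: G) ->
    (forall h', colon_ideal t I k.+1 h' ->
       ideal_gen b 0 r.+1 (t ^+ k.+1 *: h')) ->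
    colon_ideal t I k h -> ideal_gen b 0 r.+1 (t ^+ k *: h).
  move=> bG bJ Jh; have [A [r' def_h]] := divG h Jh.
  have [_ bD bM] := ideal_gen_is_ideal b 0 r.+1.
  have Jr : colon_ideal t I k (t *: r').
    have -> : t *: r' = h - A * G by rewrite def_h addrC addKr.
    by apply: idealB => //; have [_ _] := idJ; apply.
  rewrite def_h scalerDr scalerA -exprSr scalerAr.
  apply: bD; first exact: bM.
  by apply: bJ; rewrite /colon_ideal exprSr -scalerA.
have [G' minG' leG'] := min_monic_exists monG JSG.
have def_a' : a = (k.+1 + d.+1)%N by rewrite def_a addSnnS.
have [ltG'|eqG'] := ltnP (size G') (size G).
  have [r [j [g [[ltj jr gb szg chain] j0 g0 gen]]]] := IHd _ _ def_a' minG'.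
  pose j' i := if i is i'.+1 then j i' else k.
  pose g' i := if i is i'.+1 then g i' else G.
  exists r.+1, j', g'; split=> //; last first.
    move=> h; apply: gen_step => //.
      exact: (mem_ideal_gen (fun i => t ^+ j' i *: g' i) (k := 0%N)).
    move=> h' /gen; apply: ideal_gen_sub; first exact: ideal_gen_is_ideal.
    move=> i lt_ir.
    exact: (mem_ideal_gen (fun i => t ^+ j' i *: g' i) (k := i.+1)).
  split=> // [[|i]|[|i]|[|i]|[|i]] /=; rewrite ?j0 ?g0 //.
  - exact: ltj.
  - exact: gb.
  - exact: szg.
  - by move=> _; apply/ideal_gen_shift/gen.
  - by move=> lt_ir; apply/ideal_gen_shift/chain.
have minSG : min_monic (colon_ideal t I k.+1) G.
  case: minG' => _ _ minG'; split=> // H monH JH.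
  exact: leq_trans eqG' (minG' H monH JH).
have [r [j [g [[ltj jr gb szg chain] j0 g0 gen]]]] := IHd _ _ def_a' minSG.
pose j' i := if i is i'.+1 then j i'.+1 else k.
exists r, j', g; split=> //; last first.
  have b'G : ideal_gen (fun i => t ^+ j' i *: g i) 0 r.+1 (t ^+ k *: G).
    by rewrite -g0; apply: (mem_ideal_gen (fun i => t ^+ j' i *: g i) (k := 0%N)).
  move=> h; apply: gen_step => // h' /gen.
  apply: ideal_gen_sub; first exact: ideal_gen_is_ideal.
  case=> [|i] lt_ir; last first.
    exact: (mem_ideal_gen (fun i => t ^+ j' i *: g i) (k := i.+1)).
  rewrite j0 g0 exprS -scalerA; apply: idealZ => //; exact: ideal_gen_is_ideal.
split=> //.
- by case=> [|i] /ltj //=; rewrite j0; apply: ltn_trans.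
- by case: (r) jr => // _; rewrite /= def_a; lia.
- by case=> [|i] /gb //=; rewrite g0; case.
- move=> i /chain; rewrite ideal_gen_shift; case: i => [|i];
  by rewrite ideal_gen_shift.
Qed.

Lemma generator_chain_lt (S : comNzRingType) (t : S) (a : nat)
    (I : {poly S} -> Prop) (r : nat) (j : nat -> nat) (g : nat -> {poly S}) :
  generator_chain t a I r j g -> (r < a)%N.
Proof.
case=> ltj jr _ _ _; apply: leq_ltn_trans jr.
have: (r <= r)%N by []; elim: {1 3 4}r => // i IHi lt_ir.
exact: leq_ltn_trans (IHi (ltnW lt_ir)) (ltj i lt_ir).
Qed.

(** The chain obtained from (I : t^0) = I, without its first term if this is f.
    The multiple c f accounts for this omission; it dies modulo f. *)
Lemma strong_generators (S : comNzRingType) (t : S) (a : nat)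
    (I : {poly S} -> Prop) (f : {poly S}) :
    t ^+ a = 0 -> local_uniformizer t -> is_ideal I -> f \is monic -> I f ->
    (exists2 q, I q & forall c, q <> c * f) ->
  exists r j g, let b i := t ^+ j i *: g i in
    [/\ generator_chain t a I r j g, (size (g 0%N) < size f)%N,
        ideal_gen b 0 r.+1 (t ^+ j 0%N *: f) &
        forall h, I h -> exists c, ideal_gen b 0 r.+1 (h - c * f)].
Proof.
move=> ta0 locS idI monf If [q Iq qNf].
have a_gt0 : (0 < a)%N.
  by case: a ta0 => // /eqP; rewrite expr0 oner_eq0.
have I0P h : colon_ideal t I 0 h <-> I h by rewrite /colon_ideal expr0 scale1r.
have [G minG leG] := min_monic_exists monf (proj2 (I0P f) If).
have [ltG|eqG] := ltnP (size G) (size f).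
  (* Here f is a member of I like any other, so c = 0 will do. *)
  have [r [j [g [chain j0 g0 gen]]]] :=
    min_monic_chain ta0 locS idI a_gt0 minG.
  have gen0 h : I h -> ideal_gen (fun i => t ^+ j i *: g i) 0 r.+1 h.
    by move=> Ih; rewrite -[h]scale1r -(expr0 t); apply/gen/I0P.
  exists r, j, g; split; rewrite ?g0 //; first by rewrite j0; apply/gen/I0P.
  by move=> h Ih; exists 0; rewrite mul0r subr0; apply: gen0.
have minf : min_monic (colon_ideal t I 0) f.
  split=> //; first exact/I0P.
  by case: minG => _ _ minG H monH JH; apply: leq_trans eqG (minG H monH JH).
have [r [j [g [chain j0 g0 gen]]]] := min_monic_chain ta0 locS idI a_gt0 minf.
have gen0 h : I h -> exists c : nat -> {poly S},
    h = c 0%N * f + \sum_(0 <= i < r) c i.+1 * (t ^+ j i.+1 *: g i.+1).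
  move/I0P/gen; rewrite expr0 scale1r => -[c ->]; exists c.
  by rewrite big_nat_recl // j0 g0 expr0 scale1r.
(* A chain reduced to f would give I = <f>. *)
case: r chain {gen} gen0 => [|r] [ltj jr gb szg chain] gen0.
  have [c def_q] := gen0 q Iq.
  by case: (qNf (c 0%N)); rewrite {1}def_q big_nil addr0.
exists r, (fun i => j i.+1), (fun i => g i.+1); split.
- split=> // i; try exact: (ltj i.+1); try exact: (gb i.+1).
    exact: (szg i.+1).
  by move=> lt_ir; apply: (proj1 (ideal_gen_shift _ _ _ _) (chain i.+1 lt_ir)).
- by rewrite -g0; apply: szg.
- by rewrite -g0; apply: (proj1 (ideal_gen_shift _ _ _ _) (chain 0%N _)).
- move=> h /gen0[c def_h]; exists (c 0%N), (fun i => c i.+1).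
  by rewrite {1}def_h addrC addKr.
Qed.

(** * Galois rings *)

Section ModP.

Variables (p a : nat).
Hypotheses (p_prime : prime p) (a_gt0 : (0 < a)%N).

Let pa_gt1 : (1 < p ^ a)%N.
Proof. by rewrite -(exp1n a) ltn_exp2r ?prime_gt1. Qed.

Let redp (x : 'Z_(p ^ a)) : 'F_p := (x : nat)%:R.

(* The reduction is a ring morphism because p divides p ^ a. *)
Let redp_modn (n : nat) : (n %% p ^ a)%:R = n%:R :> 'F_p.
Proof.
rewrite [in RHS](divn_eq n (p ^ a)) natrD natrM natrX.
by rewrite (pcharf0 (pchar_Fp p_prime)) expr0n gtn_eqF // mulr0 add0r.
Qed.

Let redp_val (n : nat) : redp (n%:R) = n%:R.
Proof. by rewrite /redp val_Zp_nat // redp_modn. Qed.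

Let redp_zmod : zmod_morphism redp.
Proof.
move=> x y; apply/eqP; rewrite eq_sym subr_eq; apply/eqP.
rewrite -[in LHS](subrK y x) -[x - y]natr_Zp -[y]natr_Zp -natrD !redp_val.
by rewrite natrD.
Qed.

Let redp_monoid : monoid_morphism redp.
Proof.
split=> [|x y]; first exact: (redp_val 1).
by rewrite -[x]natr_Zp -[y]natr_Zp -natrM !redp_val natrM.
Qed.

HB.instance Definition _ := GRing.isZmodMorphism.Build _ _ redp redp_zmod.
HB.instance Definition _ := GRing.isMonoidMorphism.Build _ _ redp redp_monoid.


Let redp_poly : {rmorphism {poly 'Z_(p ^ a)} -> {poly 'F_p}} := map_poly redp.

Let redp_poly_lift (w : {poly 'F_p}) : exists W, redp_poly W = w.
Proof.
exists (map_poly (fun c : 'F_p => (c : nat)%:R) w); apply/polyP => i.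
by rewrite coef_map coef_map_id0 //= redp_val natr_Zp.
Qed.

Let redp_poly_ker (V : {poly 'Z_(p ^ a)}) :
  redp_poly V = 0 -> exists W, V = p%:R * W.
Proof.
move=> V0; exists (map_poly (fun c : 'Z_(p ^ a) => (c %/ p)%:R) V).
apply/polyP => i; rewrite mulr_natl coefMn coef_map_id0 ?div0n //.
have /eqP := congr1 (fun w : {poly 'F_p} => w`_i) V0.
rewrite coef0 coef_map /= /redp -(dvdn_pcharf (pchar_Fp p_prime)) => p_dv.
by rewrite -mulrnA divnK // natr_Zp.
Qed.

Lemma galois_ring_uniformizer_nilpotent (m : nat) (GR : comNzRingType) :
  is_galois_ring p a m GR -> (p%:R : GR) ^+ a = 0.
Proof.
case=> h [phi _]; rewrite -natrX -(rmorph_nat phi).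
rewrite -(rmorph_nat (polyC : 'Z_(p ^ a) -> _)).
suff -> : (p ^ a)%:R = 0 :> 'Z_(p ^ a) by rewrite !rmorph0.
by apply/val_inj; rewrite /= val_Zp_nat // modnn.
Qed.

(** Modulo p, the irreducible h is either coprime to q or divides it, q being a
    representative of x: the first case makes x a unit, the second a multiple
    of p. *)
Lemma galois_ring_local (m : nat) (GR : comNzRingType) :
  is_galois_ring p a m GR -> local_uniformizer (p%:R : GR).
Proof.
move=> hGR x; have := galois_ring_uniformizer_nilpotent hGR.
case: hGR => h [phi [_ _ [_ h_irr] [phi_surj phi_ker]]] pa0.
have phi_h : phi h = 0 by apply/phi_ker; exists 1; rewrite mul1r.
have {x} [q <-] := phi_surj x.
have [cop|ncop] := boolP (coprimep (redp_poly h) (redp_poly q)).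
  right; have [[u v] /= Buv] := Bezout_eq1_coprimepP _ _ cop.
  have [U dU] := redp_poly_lift u; have [V dV] := redp_poly_lift v.
  have [|W dW] := @redp_poly_ker (1 - (U * h + V * q)).
    by rewrite rmorphB rmorphD !rmorphM rmorph1 dU dV Buv subrr.
  have phiVq : phi V * phi q = 1 - p%:R * phi W.
    rewrite -(rmorph_nat phi) -!rmorphM -dW rmorphB rmorph1 rmorphD !rmorphM.
    by rewrite phi_h mulr0 add0r subKr.
  (* The inverse of 1 - p W, for the nilpotent p W, is a geometric sum. *)
  exists ((\sum_(i < a) (p%:R * phi W) ^+ i) * phi V).
  rewrite -mulrA phiVq mulrC.
  have := subrX1 (p%:R * phi W) a.
  rewrite exprMn pa0 mul0r sub0r => /(congr1 -%R); rewrite opprK -mulNr opprB.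
  by move=> <-.
left; have hq : redp_poly h %| redp_poly q.
  have := h_irr (gcdp (redp_poly h) (redp_poly q)) ncop (dvdp_gcdl _ _).
  by move=> /eqp_dvdl <-; apply: dvdp_gcdr.
have /dvdpP[w dw] := hq; have [W dW] := redp_poly_lift w.
have [|V dV] := @redp_poly_ker (q - W * h).
  by rewrite rmorphB rmorphM dW dw subrr.
exists (phi V); rewrite -(rmorph_nat phi) -rmorphM -dV rmorphB rmorphM phi_h.
by rewrite mulr0 subr0.
Qed.

End ModP.

Theorem theorem5p5 (p a m : nat) (hp : prime p) (ha : (1 <= a)%N) (hm : (1 <= m)%N)
    (GR : comNzRingType) (hGR : is_galois_ring p a m GR)
    (f : {poly GR}) (f_regular : regular_poly f) (f_monic : f \is monic)
    (Q : comPzRingType) (pi : {rmorphism {poly GR} -> Q})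
    (hQ : poly_quotient f pi)
    (C : Q -> Prop) (hC : is_ideal C) (C_neq0 : exists2 x : Q, C x & x != 0) :
  exists (r : nat) (j : nat -> nat) (g : nat -> {poly GR}),
    let b (i : nat) : {poly GR} := (p ^ j i)%:R *: g i in
    (r <= a - 1)%N /\
    (forall x : Q, C x <-> ideal_gen (fun i => pi (b i)) 0 r.+1 x) /\
    ((forall i : nat, (i < r)%N -> (j i < j i.+1)%N) /\ (j r <= a - 1)%N) /\
    (forall i : nat, (i <= r)%N -> g i \is monic) /\
    ((size (g 0%N) < size f)%N /\
     (forall i : nat, (i < r)%N -> (size (g i.+1) < size (g i))%N)) /\
    (forall i : nat, (i < r)%N ->
       ideal_gen (fun k => pi (b k)) i.+1 r.+1
         (pi ((p ^ j i.+1)%:R *: g i))) /\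
    ideal_gen b 0 r.+1 ((p ^ j 0%N)%:R *: f).
Proof.
have [pi_surj pi_ker] := hQ.
have pi_f : pi f = 0 by apply/pi_ker; exists 1; rewrite mul1r.
have idI : is_ideal (fun q => C (pi q)).
  case: hC => C0 CD CM; split=> [|x y|s x]; rewrite ?(rmorph0, rmorphD, rmorphM) //.
    exact: CD.
  exact: CM.
have If : C (pi f) by rewrite pi_f; case: hC.
have I_neq : exists2 q, C (pi q) & forall c, q <> c * f.
  case: C_neq0 => x; case: (pi_surj x) => q <- Cq q_neq0; exists q => // c def_q.
  by case/eqP: q_neq0; apply/pi_ker; exists c.
have [r [j [g [chain szg0 genf gen]]]] := strong_generators
  (galois_ring_uniformizer_nilpotent hp ha hGR) (galois_ring_local hp ha hGR)
  idI f_monic If I_neq.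
have lt_ra := generator_chain_lt chain; have [ltj jr gb szg chain4] := chain.
exists r, j, g => b.
have bE : (fun i => p%:R ^+ j i *: g i) =1 b by move=> i; rewrite /b natrX.
split; first by rewrite leq_subRL ?addn1.
split.
  move=> x; split; last first.
    apply: ideal_gen_sub => // k /andP[_ lt_kr].
    by rewrite -bE; case: (gb k lt_kr).
  have [q <-] := pi_surj x => /gen[c] /(eq_ideal_gen bE) /(ideal_gen_morph pi).
  by rewrite rmorphB rmorphM pi_f mulr0 subr0.
split; first by split=> //; rewrite leq_subRL ?addn1.
split; first by move=> i /gb[].
split=> //; split.
  move=> i /chain4 /(eq_ideal_gen bE) /(ideal_gen_morph pi).
  by rewrite natrX.
by rewrite natrX; apply: eq_ideal_gen genf.
Qed.
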